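(* Let $q$ be an odd prime power, let $n\geq 1$, and let $A_n\in\mathbb F_q^{n\times n}$ be uniformly random. For every integer $t$ with $0\leq t\leq n-1$, one has \[ d_{\mathrm{TV}}\!\left(\mathcal L(\operatorname{per}(A_n)),\mathsf U_q\right) \leq \frac{(q-1)(2q-1)}{q^3}\,\frac{t}{n} + \frac{1}{q^2}\left(1-\left(1-\frac{1}{q}\right)^3\right)^t . \]
   Context: $\mathbb F_q$ is the finite field with $q$ elements. For $A=(a_{ij})\in\mathbb F_q^{n\times n}$, the permanent is $\operatorname{per}(A)=\sum_{\sigma\in S_n}\prod_{i=1}^n a_{i,\sigma(i)}\in\mathbb F_q$, where $S_n$ is the symmetric group on $[n]=\{1,\dots,n\}$. A uniformly random matrix has independent entries, each uniformly distributed on $\mathbb F_q$. For probability measures $\mu,\nu$ on $\mathbb F_q$, $d_{\mathrm{TV}}(\mu,\nu)=\frac12\sum_{x\in\mathbb F_q}|\mu(x)-\nu(x)|$. $\mathsf U_q$ is the uniform probability measure on $\mathbb F_q$, and $\mathcal L(X)$ is the law of a random variable $X$. *)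

(* Defs.v *)
From HB Require Import structures.
From mathcomp Require Import all_boot all_order all_fingroup all_algebra.
From mathcomp Require Import all_classical all_reals all_analysis.

Set Implicit Arguments.
Unset Strict Implicit.
Unset Printing Implicit Defensive.

Import Order.TTheory GRing.Theory Num.Theory.

Local Open Scope classical_set_scope.
Local Open Scope ring_scope.

Definition permanent (R : comNzRingType) (n : nat) (A : 'M[R]_n) : R :=
  \sum_(s : 'S_n) \prod_(i < n) A i (s i).

(* A finite set of values carries the discrete sigma-algebra, so every
   preimage has to be measurable. *)
Definition discrete_rv (d : measure_display) (Omega : measurableType d)
    (T : finType) (X : Omega -> T) : Prop :=
  forall B : set T, measurable (X @^-1` B).

Definition mutually_independent (d : measure_display) (Omega : measurableType d)
    (R : realType) (P : probability Omega R) (I T : finType)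
    (X : I -> Omega -> T) : Prop :=
  forall (J : {set I}) (B : I -> set T),
    P (\bigcap_(i in [set` J]) X i @^-1` B i) =
    (\prod_(i in J) P (X i @^-1` B i))%E.

(* A measure on a finite type is given by its point masses. *)
Definition law (d : measure_display) (Omega : measurableType d)
    (R : realType) (P : probability Omega R) (T : finType)
    (X : Omega -> T) : T -> R :=
  fun x => fine (P (X @^-1` [set x])).

Definition uniform_law (R : realType) (T : finType) : T -> R :=
  fun=> (#|T|%:R)^-1.

Definition d_TV (R : realType) (T : finType) (mu nu : T -> R) : R :=
  2^-1 * \sum_(x : T) `|mu x - nu x|.

Definition uniform_random_matrix (d : measure_display)
    (Omega : measurableType d) (R : realType) (P : probability Omega R)
    (F : finFieldType) (n : nat) (A : Omega -> 'M[F]_n) : Prop :=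
  let entry (ij : 'I_n * 'I_n) (w : Omega) := A w ij.1 ij.2 in
  [/\ forall ij, discrete_rv (entry ij),
      mutually_independent P entry
    & forall ij, law P (entry ij) = @uniform_law R F].

(* Main.v *)
Require Import Defs.
From HB Require Import structures.
From mathcomp Require Import all_boot all_order all_fingroup all_algebra.
From mathcomp Require Import finfield ring lra zify.

(** Write [q] for the size of the field, [c = (2q - 1) / q^2] and [W m n] for
    the probability that a uniform [m x n] matrix, [m <= n], is degenerate: all
    its permanents of [m] columns vanish.

    Reduction.  Expanding along the first row, the permanent of a square matrix
    of size [n] is a linear form in that row, whose coefficients are the
    permanental minors of the [n - 1] other rows.  If those minors do not all
    vanish the permanent is exactly uniform, otherwise it is zero; hence the
    distance to the uniform law is exactly [(1 - 1/q) W (n-1) n]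
    ([d_TV_permanent]).

    Algebra.  The minors of a matrix [C] are the coefficients of the product of
    its rows, read as linear forms in [F[X_1, ..., X_n] / (X_1^2, ..., X_n^2)].
    A new row [x] makes the matrix degenerate when [x] annihilates that product,
    so [W (m+1) n] is the expected density of the annihilator [K_C] of the
    product of [m] random rows.

    One step ([deg_prob_rec]).  Suppose that [C] has [m] rows, at least
    [m + 2] columns and is not degenerate.  A suitable coefficient of
    [x y C], as a function of [x] and [y], is a nonzero symmetric bilinear form
    whose radical contains [K_C] and which vanishes on each pair [(e_i, e_i)].
    Since [q] is odd, its quadratic form is nonzero and has a zero set [X] of
    density at most [c] ([quadric_density]).  All the vectors [a e_i] lie in
    [X], which is a union of cosets of [K_C].  So two random points on the axes
    are squeezed into few cosets, and by Cauchy-Schwarz they agree modulo [K_C]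
    with probability at least [1 / c] times the density of [K_C]
    ([collision_bound]).  On the other hand, two distinct points [a e_i] and
    [b e_j] agree modulo [K_C], for a random [C], with probability exactly
    [W m (n-1)]: if [i <> j] they do so when the matrix obtained by merging the
    columns [i] and [j] is degenerate, and if [i = j] when the deletion of that
    column leaves a degenerate matrix ([mean_annihilates_pair]).  Together:
    [W (m+1) n <= c W m (n-1) + (1 - c) W m n + c / (n (q - 1))].

    Iteration ([deg_prob_bound]).  Removing a row either keeps [n - m] fixed,
    with weight [c], or increases it by one, with weight [1 - c].  As
    [W m n <= q^-(n-m) / (q - 1)] ([deg_prob_le]), the latter gains a factor
    [1/q], so [t] steps gain [(c + (1 - c) / q)^t = (1 - (1 - 1/q)^3)^t], while
    the error terms add up to at most [c t / n] as long as this is smaller than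
    the bound that holds without iterating. *)

Set Implicit Arguments.
Unset Strict Implicit.
Unset Printing Implicit Defensive.

Import Order.TTheory GRing.Theory Num.Theory.

Local Open Scope ring_scope.

(** * Products of linear forms and permanental minors *)

Section Minors.
Variable F : finFieldType.

(** A function [T] on subsets stands for [\sum_J T(J) X^J] in the polynomial
    ring modulo the squares of the variables; this is its product with the
    linear form [\sum_j x_j X_j]. *)
Definition linmul n (x : 'rV[F]_n) (T : {set 'I_n} -> F) (J : {set 'I_n}) : F :=
  \sum_(j in J) x 0 j * T (J :\ j).

(** The coefficient of [X^J] in the product of the rows, that is, the permanent
    of the columns in [J] when [#|J| = m], and zero otherwise.  Expanding row by
    row avoids enumerating injections. *)
Fixpoint pminor m n : 'M[F]_(m, n) -> {set 'I_n} -> F :=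
  match m with
  | 0 => fun _ J => (J == set0)%:R
  | m'.+1 => fun B : 'M[F]_(1 + m', n) =>
      linmul (usubmx B) (pminor (dsubmx B))
  end.

Definition degenerate m n (B : 'M[F]_(m, n)) : bool :=
  [forall J, pminor B J == 0].

Definition annihilates m n (x : 'rV[F]_n) (C : 'M[F]_(m, n)) : bool :=
  [forall J, linmul x (pminor C) J == 0].

Lemma linmulDl n (x y : 'rV[F]_n) T J :
  linmul (x + y) T J = linmul x T J + linmul y T J.
Proof.
by rewrite /linmul -big_split; apply: eq_bigr => j _; rewrite mxE mulrDl.
Qed.

Lemma linmulZl n a (x : 'rV[F]_n) T J : linmul (a *: x) T J = a * linmul x T J.
Proof.
by rewrite /linmul mulr_sumr; apply: eq_bigr => j _; rewrite mxE mulrA.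
Qed.

Lemma linmul0r n (x : 'rV[F]_n) T J : (forall I, T I = 0) -> linmul x T J = 0.
Proof. by move=> T0; apply: big1 => j _; rewrite T0 mulr0. Qed.

Lemma linmul_delta n (i : 'I_n) T J :
  linmul (delta_mx 0 i) T J = (i \in J)%:R * T (J :\ i).
Proof.
rewrite /linmul; case: (boolP (i \in J)) => iJ.
  rewrite (bigD1 i) //= mxE !eqxx big1 ?addr0 // => j /andP[_ ji].
  by rewrite mxE eqxx (negPf ji) mul0r.
rewrite mul0r big1 // => j jJ; rewrite mxE eqxx /=.
by case: eqP jJ iJ => [->|_ _ _]; [move=> ->|rewrite mul0r].
Qed.

(** The algebra is commutative: both sides sum over ordered pairs of distinct
    elements of [J]. *)
Lemma linmulC n (x y : 'rV[F]_n) T J :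
  linmul x (linmul y T) J = linmul y (linmul x T) J.
Proof.
have expand (u v : 'rV[F]_n) : linmul u (linmul v T) J =
    \sum_(j in J) \sum_(l in J | l != j) u 0 j * v 0 l * T (J :\ j :\ l).
  apply: eq_bigr => j jJ; rewrite /linmul mulr_sumr.
  by apply: eq_big => l; [rewrite !inE andbC|rewrite mulrA].
rewrite !expand (exchange_big_dep (mem J)) /=; last by move=> j l _ /andP[].
apply: eq_bigr => j jJ; apply: eq_big => [l|l _]; first by rewrite jJ eq_sym.
by rewrite setDDl setUC -setDDl (mulrC (x _ _)).
Qed.

Lemma pminor_col_mx m n (x : 'rV[F]_n) (C : 'M[F]_(m, n)) J :
  pminor (col_mx x C : 'M_(m.+1, n)) J = linmul x (pminor C) J.
Proof. by rewrite /= col_mxKu col_mxKd. Qed.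

Lemma degenerate_col_mx m n (x : 'rV[F]_n) (C : 'M[F]_(m, n)) :
  degenerate (col_mx x C : 'M_(m.+1, n)) = annihilates x C.
Proof. by apply: eq_forallb => J; rewrite pminor_col_mx. Qed.

Lemma degenerate_annihilates m n (x : 'rV[F]_n) (C : 'M[F]_(m, n)) :
  degenerate C -> annihilates x C.
Proof.
move=> /forallP C0; apply/forallP => J.
by rewrite linmul0r // => I; apply/eqP/C0.
Qed.

Lemma pminor_card m n (B : 'M[F]_(m, n)) (J : {set 'I_n}) :
  #|J| != m -> pminor B J = 0.
Proof.
elim: m B J => [|m IHm] B J /=; first by rewrite cards_eq0 => /negPf->.
move=> Jm; apply: big1 => j jJ; rewrite IHm ?mulr0 //.
by apply: contra Jm; rewrite (cardsD1 j J) jJ => /eqP ->.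
Qed.

Lemma pminor_col' m n (i : 'I_n.+1) (C : 'M[F]_(m, n.+1)) (J : {set 'I_n}) :
  pminor (col' i C) J = pminor C (lift i @: J).
Proof.
elim: m C J => [|m IHm] C J /=; first by rewrite -!cards_eq0 card_imset //; apply: lift_inj.
rewrite /linmul big_imset /=; last by move=> ? ? _ _; apply: lift_inj.
apply: eq_bigr => j _; congr (_ * _); first by rewrite !mxE.
have -> : lift i @: J :\ lift i j = lift i @: (J :\ j).
  apply/setP => s; apply/setD1P/imsetP => [[sj /imsetP[l lJ sE]]|[l]].
    by exists l; rewrite // !inE lJ andbT; apply: contra sj => /eqP <-; rewrite sE.
  rewrite !inE => /andP[lj lJ] ->; split; last exact: imset_f.
  by rewrite (inj_eq lift_inj).
rewrite -IHm; congr pminor; apply/matrixP => r s; by rewrite !mxE.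
Qed.

(** Column [i] itself is left in place: it is meant to be deleted
    afterwards. *)
Definition merge_col m n (i j : 'I_n) (a b : F) (C : 'M[F]_(m, n)) :=
  \matrix_(r, l) (if l == j then a * C r j + b * C r i else C r l).

(** A minor is linear in column [j], and the minor with column [j] replaced by
    column [i] is the one indexed by [i |: J :\ j]. *)
Lemma pminor_merge_col m n (i j : 'I_n) a b (C : 'M[F]_(m, n)) (J : {set 'I_n}) :
    i != j -> i \notin J ->
  pminor (merge_col i j a b C) J =
    if j \in J then a * pminor C J + b * pminor C (i |: J :\ j) else pminor C J.
Proof.
move=> neq_ij; elim: m C J => [|m IHm] C J iJ.
  rewrite /=; case: ifP => // jJ.
  have ->: (J == set0) = false by apply/negbTE/set0Pn; exists j.
  have ->: (i |: J :\ j == set0) = false by apply/negbTE/set0Pn; exists i; rewrite !inE eqxx.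
  by rewrite !mulr0 addr0.
have dm : dsubmx (merge_col i j a b C : 'M_(1 + m, n)) = merge_col i j a b (dsubmx (C : 'M_(1 + m, n))).
  by apply/matrixP => r s; rewrite !mxE.
have um l : usubmx (merge_col i j a b C : 'M_(1 + m, n)) 0 l =
   if l == j then a * usubmx (C : 'M_(1 + m, n)) 0 j + b * usubmx (C : 'M_(1 + m, n)) 0 i
   else usubmx (C : 'M_(1 + m, n)) 0 l by rewrite !mxE.
rewrite /= dm; set D := dsubmx _; set x := usubmx (C : 'M_(1 + m, n)).
have iJD l : i \notin J :\ l by rewrite !inE negb_and iJ orbT.
case: ifP => jJ; last first.
  apply: eq_bigr => l lJ; rewrite um IHm // !inE jJ andbF.
  by case: eqP => // lj; rewrite -lj lJ in jJ.
have -> : linmul x (pminor D) J = x 0 j * pminor D (J :\ j) +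
    \sum_(l in J | l != j) x 0 l * pminor D (J :\ l).
  by rewrite /linmul (bigD1 j).
have -> : linmul x (pminor D) (i |: J :\ j) = x 0 i * pminor D (J :\ j) +
    \sum_(l in i |: J :\ j | l != i) x 0 l * pminor D ((i |: J :\ j) :\ l).
  by rewrite /linmul (bigD1 i) ?setU11 //= setU1K.
rewrite /linmul (bigD1 j) //= um eqxx IHm // setD11 -/x.
set S1 := \sum_(l in J | l != j) _; set S2 := \sum_(l in J | l != j) _.
set S3 := \sum_(l in _ | _) _.
suff -> : S1 = a * S2 + b * S3 by ring.
have -> : S3 = \sum_(l in J | l != j) x 0 l * pminor D (i |: (J :\ l :\ j)).
  apply: eq_big => [l|l /andP[_ li]].
    rewrite !inE; case: eqP => [->|_] /=; first by rewrite (negPf iJ).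
    by rewrite andbT andbC.
  congr (_ * pminor _ _); apply/setP => s; rewrite !inE.
  by case: (eqVneq s i) => [->|_] /=; rewrite ?andbT ?(eq_sym i) ?li // andbCA.
rewrite !mulr_sumr -big_split; apply: eq_bigr => l /andP[lJ lj] /=.
rewrite um (negPf lj) IHm // !inE eq_sym lj jJ /= -/x; ring.
Qed.

(** Let column [j] of [C] become [a C_j + b C_i].  The coefficient of [X^J] in
    the product of [a X_i + b X_j] with the rows of [C] is a minor of the new
    matrix using column [j] but not column [i] when [J] contains both indices,
    and a multiple, by [a] or [b], of a minor avoiding both columns when it
    contains only one. *)
Lemma annihilates_pair m n (i j : 'I_n.+1) a b (C : 'M[F]_(m, n.+1)) :
    i != j -> a != 0 ->
  annihilates (a *: delta_mx 0 i + b *: delta_mx 0 j) C =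
  degenerate (col' i (merge_col i j a b C)).
Proof.
move=> neq_ij a0; set T := pminor C.
have annE J : linmul (a *: delta_mx 0 i + b *: delta_mx 0 j) T J =
    a * ((i \in J)%:R * T (J :\ i)) + b * ((j \in J)%:R * T (J :\ j)).
  by rewrite linmulDl !linmulZl !linmul_delta.
apply/forallP/forallP => [annC J|degC J].
  rewrite pminor_col'; set J' := _ @: J.
  have iJ' : i \notin J' by apply/imsetP => -[l _ /eqP]; rewrite (negPf (neq_lift _ _)).
  rewrite pminor_merge_col // -/T; have:= annC (i |: J').
  rewrite annE setU11 setU1K // mul1r !inE (eq_sym j) (negPf neq_ij) /=.
  case: ifP => jJ'; last by rewrite mul0r mulr0 addr0 mulf_eq0 (negPf a0).
  have -> : (i |: J') :\ j = i |: J' :\ j.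
    by apply/setP => s; rewrite !inE; case: (eqVneq s i) => // ->; rewrite neq_ij.
  by rewrite mul1r.
have degC' (J' : {set 'I_n.+1}) : i \notin J' ->
    (if j \in J' then a * T J' + b * T (i |: J' :\ j) else T J') = 0.
  move=> iJ'; rewrite -pminor_merge_col //.
  have -> : J' = lift i @: (lift i @^-1: J').
    apply/setP => s; apply/idP/imsetP => [sJ|[l]]; last by rewrite inE => ? ->.
    case: (unliftP i s) => [l|] sE; last by rewrite sE (negPf iJ') in sJ.
    by exists l; rewrite // inE -sE.
  by rewrite -pminor_col'; apply/eqP.
rewrite annE; case: (boolP (i \in J)) => iJ; case: (boolP (j \in J)) => jJ /=.
- have := degC' (J :\ i); rewrite !inE eqxx /= (eq_sym j) neq_ij jJ => /(_ isT).
  have -> : i |: J :\ i :\ j = J :\ j.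
    apply/setP => s; rewrite !inE; case: (eqVneq s i) => // ->.
    by rewrite neq_ij iJ.
  by rewrite /= !mul1r => ->.
- have := degC' (J :\ i); rewrite !inE eqxx (negPf jJ) andbF /= => /(_ isT) ->.
  by rewrite mul0r !mulr0 addr0.
- have := degC' (J :\ j); rewrite !inE eqxx (negPf iJ) andbF /= => /(_ isT) ->.
  by rewrite mul0r !mulr0 addr0.
- by rewrite !mul0r !mulr0 addr0.
Qed.

End Minors.

(** * Averages over finite types *)

Section Mean.
Variable R : realFieldType.

Definition mean (T : finType) (f : T -> R) : R := (\sum_x f x) / #|T|%:R.

Lemma eq_mean (T : finType) (f g : T -> R) : f =1 g -> mean f = mean g.
Proof. by move=> fg; rewrite /mean (eq_bigr g) // => x _; rewrite fg. Qed.

Lemma mean_const (T : finType) (a : R) : (0 < #|T|)%N -> mean (fun _ : T => a) = a.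
Proof.
by move=> T0; rewrite /mean sumr_const -(mulr_natr a) mulfK // pnatr_eq0 -lt0n.
Qed.

Lemma meanD (T : finType) (f g : T -> R) :
  mean (fun x => f x + g x) = mean f + mean g.
Proof. by rewrite /mean big_split mulrDl. Qed.

Lemma meanZ (T : finType) (a : R) (f : T -> R) :
  mean (fun x => a * f x) = a * mean f.
Proof. by rewrite /mean -mulr_sumr mulrA. Qed.

Lemma mean_le (T : finType) (f g : T -> R) :
  (forall x, f x <= g x) -> mean f <= mean g.
Proof.
by move=> fg; rewrite ler_wpM2r ?invr_ge0 ?ler0n //; apply: ler_sum => x _.
Qed.

Lemma mean_ge0 (T : finType) (f : T -> R) : (forall x, 0 <= f x) -> 0 <= mean f.
Proof. by move=> f0; rewrite mulr_ge0 ?invr_ge0 ?ler0n //; apply: sumr_ge0. Qed.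

Lemma mean_le1 (T : finType) (b : T -> bool) : mean (fun x => (b x)%:R) <= 1.
Proof.
case: (posnP #|T|) => [T0|T0]; first by rewrite /mean T0 invr0 mulr0 ler01.
rewrite -[X in _ <= X](mean_const _ T0); apply: mean_le => x; by rewrite lern1 leq_b1.
Qed.

Lemma mean_bij (T U : finType) (h : T -> U) (f : U -> R) :
  bijective h -> mean (fun x => f (h x)) = mean f.
Proof.
move=> bij_h; rewrite /mean (bij_eq_card bij_h); congr (_ / _).
by rewrite [RHS](reindex h) //; apply: onW_bij.
Qed.

Lemma mean_pair (T U : finType) (f : T -> U -> R) :
  mean (fun p : T * U => f p.1 p.2) = mean (fun x => mean (f x)).
Proof.
rewrite /mean -mulr_suml card_prod natrM invfM -(pair_bigA _ f) /=.
by rewrite [_^-1 * _^-1]mulrC mulrA.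
Qed.

Lemma exchange_mean (T U : finType) (f : T -> U -> R) :
  mean (fun x => mean (f x)) = mean (fun y => mean (fun x => f x y)).
Proof.
by rewrite /mean -!mulr_suml exchange_big mulrAC.
Qed.

Lemma mean_pred1 (T : finType) (y : T) : mean (fun x => (x == y)%:R) = #|T|%:R^-1.
Proof.
rewrite /mean (bigD1 y) //= eqxx big1 ?addr0 ?mul1r // => x /negPf -> //.
Qed.

Lemma sum_CauchySchwarz (T : finType) (u v : T -> R) :
  (\sum_x u x * v x) ^+ 2 <= (\sum_x u x ^+ 2) * \sum_x v x ^+ 2.
Proof.
set a := \sum_x u x ^+ 2; set b := \sum_x _; set c := \sum_x v x ^+ 2.
have a_ge0 : 0 <= a by apply: sumr_ge0 => x _; apply: sqr_ge0.
have [a0|a_neq0] := eqVneq a 0.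
  have u0 x : u x = 0.
    have := psumr_eq0P (fun x _ => sqr_ge0 (u x)) a0 => /(_ x isT) /eqP.
    by rewrite sqrf_eq0 => /eqP.
  by rewrite /b big1 ?expr0n ?a0 ?mul0r // => x _; rewrite u0 mul0r.
have a_gt0 : 0 < a by rewrite lt_def a_neq0.
have : 0 <= \sum_x (a * v x - b * u x) ^+ 2.
  by apply: sumr_ge0 => x _; apply: sqr_ge0.
have -> : \sum_x (a * v x - b * u x) ^+ 2 = a * (a * c - b ^+ 2).
  transitivity (a ^+ 2 * c - (a * b *+ 2) * b + b ^+ 2 * a); last by ring.
  rewrite [a ^+ 2 * c]mulr_sumr [_ *+ 2 * b]mulr_sumr [_ ^+ 2 * a]mulr_sumr.
  rewrite -sumrB -big_split /=.
  by apply: eq_bigr => x _; ring.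
by rewrite pmulr_rge0 // subr_ge0.
Qed.

(** Second-moment method: if [K] is a subgroup, the points [w i] occupy at most
    [#|X| / #|K|] cosets of [K], so two of them often share a coset.  The proof
    avoids quotients by applying Cauchy-Schwarz to the number [g y] of indices
    [i] for which [w i] lies in the coset of [y]; it is supported on [X]. *)
Lemma collision_bound (V : finZmodType) (I : finType) (w : I -> V)
    (K X : pred V) :
    (0 < #|I|)%N -> K 0 ->
    (forall x y, K x -> K y -> K (x - y)) ->
    (forall x y, X x -> K (y - x) -> X y) ->
    (forall i, X (w i)) ->
  mean (fun x => (K x)%:R) <=
    mean (fun x => (X x)%:R) * mean (fun p => (K (w p.1 - w p.2))%:R).
Proof.
move=> I_gt0 K0 KB KX wX.
set k : R := \sum_x (K x)%:R; set nX : R := \sum_x (X x)%:R.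
set P : R := \sum_p (K (w p.1 - w p.2))%:R.
have KD x y : K x -> K y -> K (x + y).
  move=> Kx Ky; rewrite -[y]opprK; apply: (KB _ _ Kx).
  by rewrite -sub0r; apply: KB.
have k_gt0 : 0 < k.
  by rewrite /k (bigD1 0) //= K0 ltr_pwDl // sumr_ge0 // => x _; rewrite ler0n.
have shift a : \sum_y (K (y - a))%:R = k.
  rewrite /k [RHS](reindex_inj (addIr (- a))); exact: eq_bigr.
pose g y : R := \sum_i (K (y - w i))%:R.
have sum_g : \sum_y (X y)%:R * g y = #|I|%:R * k.
  transitivity (\sum_y g y).
    apply: eq_bigr => y _; case: (boolP (X y)) => Xy; first by rewrite mul1r.
    rewrite mul0r /g big1 // => i _; case: (boolP (K _)) => // Ky.
    by rewrite (KX _ _ (wX i) Ky) in Xy.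
  rewrite exchange_big /= (eq_bigr (fun=> k)) => [|i _]; last exact: shift.
  by rewrite sumr_const -(mulr_natl k).
have sum_g2 : \sum_y g y ^+ 2 = k * P.
  transitivity (\sum_y \sum_(p : I * I) (K (y - w p.1))%:R * (K (w p.1 - w p.2))%:R : R).
    apply: eq_bigr => y _; rewrite expr2 /g mulr_suml.
    rewrite -(pair_bigA _ (fun i j => (K (y - w i))%:R * (K (w i - w j))%:R)) /=.
    apply: eq_bigr => i _; rewrite mulr_sumr; apply: eq_bigr => j _.
    case: (boolP (K (y - w i))) => Kyi; rewrite ?mul0r // !mul1r.
    congr (nat_of_bool _)%:R; apply/idP/idP => Kj.
      by have := KB _ _ Kj Kyi; rewrite addrC opprB subrKA.
    by have := KD _ _ Kyi Kj; rewrite subrKA.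
  rewrite exchange_big /= mulr_sumr; apply: eq_bigr => p _.
  by rewrite -mulr_suml shift.
have := sum_CauchySchwarz (fun y => (X y)%:R) g.
rewrite sum_g sum_g2 (eq_bigr (fun y => (X y)%:R)) => [|y _]; last first.
  by case: (X y); rewrite ?expr1n ?expr0n.
rewrite -/nX => CS.
have {CS} CS : #|I|%:R ^+ 2 * k <= nX * P.
  by rewrite -(ler_pM2r k_gt0); lra.
have V_gt0 : 0 < #|V|%:R :> R.
  by rewrite ltr0n; apply/card_gt0P; exists 0.
have I2_gt0 : 0 < #|I|%:R ^+ 2 :> R by rewrite exprn_gt0 // ltr0n.
rewrite /mean -/k -/nX -/P card_prod natrM -expr2 mulrAC mulrA.
by rewrite ler_pM2r ?invr_gt0 // ler_pdivlMr // mulrC.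
Qed.

End Mean.

(** * Degenerate random matrices *)

Section Degeneracy.
Variables (R : realFieldType) (F : finFieldType).
Hypothesis odd_F : odd #|F|.
Let q : R := #|F|%:R.

Lemma ler_of_eq (x y : R) : x = y -> x <= y.
Proof. by move->. Qed.

Lemma card_odd_field_ge3 : 3 <= q.
Proof.
rewrite /q ler_nat; have := card_finNzRing_gt1 F.
by case: #|F| odd_F => [|[|[|]]].
Qed.

(** The additive order of [1] divides the odd number [#|F|]. *)
Lemma two_neq0_odd : (2 : F) != 0.
Proof.
apply/eqP => F2; have : (#|F|%:R : F) = 0.
  have := cyclic.expg_cardG (in_setT (1 : F)).
  by rewrite FinRing.zmodXgE cardsT.
rewrite -(odd_double_half #|F|) odd_F natrD -muln2 natrM F2 mulr0 addr0.
by apply/eqP; rewrite oner_eq0.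
Qed.

Lemma mean_affine_root (a b : F) :
  b != 0 -> mean (fun x => (a + x * b == 0)%:R) = q^-1.
Proof.
move=> b0; rewrite -(mean_pred1 R (- a / b)); apply: eq_mean => x.
congr (nat_of_bool _)%:R.
by rewrite -[RHS](inj_eq (mulIf b0)) mulfVK // addrC addr_eq0.
Qed.

Lemma mean_affine_root_le (a b : F) :
  mean (fun x => (a + x * b == 0)%:R) <= q^-1 + (1 - q^-1) * (b == 0)%:R.
Proof.
case: (eqVneq b 0) => [_|b0]; first by rewrite mulr1 addrC subrK mean_le1.
by rewrite mulr0 addr0 mean_affine_root.
Qed.

Lemma mean_shift (V : finZmodType) (I : finType) (s : I -> V) (f : V -> R) :
  (0 < #|I|)%N -> mean f = mean (fun x => mean (fun p => f (x + s p))).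
Proof.
move=> I0; rewrite exchange_mean -[LHS](mean_const _ I0); apply: eq_mean => p.
rewrite (mean_bij f (h := fun x => x + s p)) //.
by exists (fun x => x - s p) => x; rewrite ?addrK ?subrK.
Qed.

(** On each translate of the plane spanned by the isotropic vectors [u] and [v]
    the quadratic form is [k + 2 B(u, v) (a + a0) (b + b0)] in the coordinates
    [a] and [b].  For the single value [a = - a0] it may vanish for every [b];
    for each other [a] it vanishes for exactly one [b].  This makes at most
    [q + (q - 1)] zeros among [q^2] points. *)
Lemma quadric_density (V : finLmodType F) (B : V -> V -> F) (u v : V) :
    (forall x y z, B (x + y) z = B x z + B y z) ->
    (forall a x y, B (a *: x) y = a * B x y) ->
    (forall x y, B x y = B y x) ->
    B u u = 0 -> B v v = 0 -> B u v != 0 ->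
  mean (fun x => (B x x == 0)%:R) <= (2 * q - 1) / q ^+ 2.
Proof.
move=> BD BZ BC Bu Bv Buv; have q3 := card_odd_field_ge3.
have BDr x y z : B x (y + z) = B x y + B x z by rewrite !(BC x) BD.
have BZr a x y : B x (a *: y) = a * B x y by rewrite !(BC x) BZ.
have F0 : (0 < #|F|)%N by apply/card_gt0P; exists 0.
have V0 : (0 < #|V|)%N by apply/card_gt0P; exists 0.
rewrite (mean_shift (fun p : F * F => p.1 *: u + p.2 *: v)); last first.
  by rewrite card_prod muln_gt0 F0.
have expand x a b :
    B (x + (a *: u + b *: v)) (x + (a *: u + b *: v)) =
    (B x x + a * (2 * B x u)) + b * (2 * B x v + a * (2 * B u v)).
  by rewrite !(BD, BZ, BDr, BZr) Bu Bv (BC u x) (BC v x) (BC v u); ring.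
rewrite -[X in _ <= X](mean_const _ V0); apply: mean_le => x.
rewrite (mean_pair (fun a b => (B (x + (a *: u + b *: v)) (x + (a *: u + b *: v)) == 0)%:R)).
apply: (@le_trans _ _ (q^-1 + (1 - q^-1) * q^-1)); last first.
  by apply: ler_of_eq; field; rewrite gt_eqF //; lra.
have h0 : 2 * B u v != 0 by rewrite mulf_neq0 // two_neq0_odd.
have <- : mean (fun a => q^-1 + (1 - q^-1) *
    (2 * B x v + a * (2 * B u v) == 0)%:R) = q^-1 + (1 - q^-1) * q^-1 :> R.
  by rewrite meanD mean_const // meanZ mean_affine_root.
apply: mean_le => a.
apply: le_trans (mean_affine_root_le (B x x + a * (2 * B x u)) _).
by apply: ler_of_eq; apply: eq_mean => b; rewrite expand.
Qed.

Definition deg_prob m n : R := mean (fun B : 'M[F]_(m, n) => (degenerate B)%:R).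

Lemma deg_prob_ge0 m n : 0 <= deg_prob m n.
Proof. by apply: mean_ge0 => B; rewrite ler0n. Qed.

Lemma deg_prob0 n : deg_prob 0 n = 0.
Proof.
rewrite /deg_prob /mean big1 ?mul0r // => B _; case: (boolP (degenerate B)) => //.
by move=> /forallP /(_ set0); rewrite /= eqxx oner_eq0.
Qed.

Lemma mean_col_mx m n (f : 'M[F]_(m.+1, n) -> R) :
  mean f = mean (fun C : 'M[F]_(m, n) => mean (fun x : 'rV[F]_n => f (col_mx x C))).
Proof.
rewrite exchange_mean -(mean_pair (fun (x : 'rV[F]_n) (C : 'M[F]_(m, n)) => f (col_mx x C))).
apply/esym; apply: (mean_bij f (h := fun p : 'rV[F]_n * 'M[F]_(m, n) => col_mx p.1 p.2)).
exists (fun B : 'M[F]_(1 + m, n) => (usubmx B, dsubmx B)) => [[x C]|B] /=.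
  by rewrite col_mxKu col_mxKd.
exact: vsubmxK.
Qed.

Lemma deg_probS m n : deg_prob m.+1 n =
  mean (fun C : 'M[F]_(m, n) => mean (fun x => (annihilates x C)%:R)).
Proof.
rewrite /deg_prob mean_col_mx; apply: eq_mean => C; apply: eq_mean => x.
by rewrite degenerate_col_mx.
Qed.

Lemma mean_col' m n (i : 'I_n.+1) (f : 'M[F]_(m, n) -> R) :
  mean (fun C : 'M[F]_(m, n.+1) => f (col' i C)) = mean f.
Proof.
pose h (p : 'M[F]_(m, n) * 'cV[F]_m) : 'M[F]_(m, n.+1) :=
  \matrix_(r, l) if unlift i l is Some l' then p.1 r l' else p.2 r 0.
have hK p : col' i (h p) = p.1.
  by apply/matrixP => r l; rewrite !mxE liftK.
have bij_h : bijective h.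
  exists (fun C => (col' i C, col i C)) => [[C c]|C].
    rewrite hK; congr pair; apply/matrixP => r l; rewrite !mxE unlift_none.
    by rewrite (ord1 l).
  by apply/matrixP => r l; rewrite !mxE; case: unliftP => [l'|] ->; rewrite ?mxE.
rewrite -(mean_bij _ bij_h) -(eq_mean (f := fun p => f p.1)) => [|p]; last first.
  by rewrite hK.
rewrite (mean_pair (fun C _ => f C)); apply: eq_mean => C; apply: mean_const.
by apply/card_gt0P; exists 0.
Qed.

Lemma merge_col_bij m n (i j : 'I_n) (a b : F) : i != j -> a != 0 ->
  bijective (@merge_col F m n i j a b).
Proof.
move=> neq_ij a0; exists (merge_col i j a^-1 (- b / a)) => C;
  apply/matrixP => r l; rewrite !mxE eqxx (negPf neq_ij);
  by case: eqP => // ->; field.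
Qed.

(** The matrix with merged columns and column [i] deleted is again uniform. *)
Lemma mean_annihilates_pair m n (i j : 'I_n.+1) (a b : F) :
    i != j -> a != 0 ->
  mean (fun C : 'M[F]_(m, n.+1) =>
    (annihilates (a *: delta_mx 0 i + b *: delta_mx 0 j) C)%:R) = deg_prob m n.
Proof.
move=> neq_ij a0; rewrite /deg_prob -(mean_col' i).
rewrite -[RHS](mean_bij _ (merge_col_bij m b neq_ij a0)); apply: eq_mean => C.
by rewrite annihilates_pair.
Qed.

(** Using all the nonzero multiples of the basis vectors, and not just the
    vectors themselves, lowers the probability that two random points coincide
    to [1 / (n (q - 1))]; the induction in [deg_prob_bound] needs the factor
    [1 / (q - 1) <= 1 / 2]. *)
Definition axis_point n (p : 'I_n * {unit F}) : 'rV[F]_n :=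
  val p.2 *: delta_mx 0 p.1.

Lemma card_axis_point n : #|{: 'I_n * {unit F}}|%:R = n%:R * (q - 1).
Proof.
have q3 := card_odd_field_ge3.
rewrite card_prod card_ord natrM -cardsT card_finField_unit; congr (_ * _).
rewrite -subn1 natrB //; exact: ltnW (card_finNzRing_gt1 F).
Qed.

(** Distinct axis points differ by a vector covered by [mean_annihilates_pair];
    the last term is the probability that the two points are equal. *)
Lemma mean_collision m n : (0 < n)%N ->
  mean (fun C : 'M[F]_(m, n.+1) => mean (fun p =>
    (annihilates (axis_point p.1 - axis_point p.2) C)%:R)) <=
  deg_prob m n + (n.+1%:R * (q - 1))^-1.
Proof.
move=> n0; have q3 := card_odd_field_ge3; rewrite exchange_mean.
have I0 : (0 < #|{: 'I_n.+1 * {unit F}}|)%N.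
  by apply/card_gt0P; exists (ord0, 1%g).
rewrite -card_axis_point -(mean_const (deg_prob m n) I0).
rewrite -[X in _ <= _ + X](mean_const _ I0) -meanD.
rewrite (mean_pair (fun p r => mean (fun C : 'M[F]_(m, n.+1) =>
  (annihilates (axis_point p - axis_point r) C)%:R))).
apply: mean_le => p; rewrite -(mean_pred1 R p).
rewrite -[deg_prob m n](mean_const _ I0) -meanD; apply: mean_le => r.
case: (eqVneq r p) => [_|neq_rp].
  by rewrite (le_trans (mean_le1 _ _)) // lerDr deg_prob_ge0.
rewrite addr0; case: p r neq_rp => [i x] [j y]; rewrite /axis_point /= => neq.
have unit_neq0 (z : {unit F}) : val z != 0 by rewrite -unitfE; apply: (valP z).
case: (eqVneq i j) => [ij|neq_ij].
  have [l il] : exists l : 'I_n.+1, i != l.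
    by exists (lift i (Ordinal n0)); apply: neq_lift.
  have xy : val x - val y != 0.
    by rewrite subr_eq0; apply: contra neq => /eqP/val_inj ->; rewrite ij.
  rewrite -(mean_annihilates_pair m 0 il xy).
  apply: ler_of_eq; apply: eq_mean => C.
  by rewrite scale0r addr0 scalerBl ij.
rewrite -(mean_annihilates_pair m (- val y) neq_ij (unit_neq0 x)).
by apply: ler_of_eq; apply: eq_mean => C; rewrite scaleNr.
Qed.

(** Two columns [i] and [j] outside a nonvanishing minor [J] are available
    because there are two more columns than rows.  The coefficient of
    [X_i X_j X^J] in [x y C] is then a symmetric bilinear form in [x], [y]
    taking the value [pminor C J] on [(e_i, e_j)], and it is hollow because
    [X_l^2 = 0]. *)
Lemma annihilator_density_collision m n (C : 'M[F]_(m, n)) :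
    (m.+2 <= n)%N -> ~~ degenerate C ->
  mean (fun x => (annihilates x C)%:R) <= (2 * q - 1) / q ^+ 2 *
    mean (fun p => (annihilates (axis_point p.1 - axis_point p.2) C)%:R) :> R.
Proof.
move=> mn /forallPn[J TJ]; set T := pminor C in TJ.
have cardJ : #|J| = m.
  by apply/eqP; apply: contraR TJ => /(pminor_card C) TJ0; rewrite /T TJ0.
have /card_gt1P[i [j [iJ jJ neq_ij]]] : (1 < #|~: J|)%N.
  by have := cardsC J; rewrite card_ord cardJ; lia.
rewrite !inE in iJ jJ.
pose B (x y : 'rV[F]_n) := linmul x (linmul y T) (i |: (j |: J)).
have BD x y z : B (x + y) z = B x z + B y z by exact: linmulDl.
have BZ a x y : B (a *: x) y = a * B x y by exact: linmulZl.
have BC x y : B x y = B y x by exact: linmulC.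
have B0 l : B (delta_mx 0 l) (delta_mx 0 l) = 0.
  by rewrite /B !linmul_delta setD11 mul0r mulr0.
have Bij : B (delta_mx 0 i) (delta_mx 0 j) != 0.
  rewrite /B !linmul_delta setU11 mul1r setU1K ?setU11 ?mul1r ?setU1K //.
  by rewrite !inE negb_or neq_ij.
have annP x : reflect (forall I, linmul x T I = 0) (annihilates x C).
  by apply: (iffP forallP) => xT I; apply/eqP/xT.
have Bann x y : annihilates x C -> B y x = 0.
  by move=> /annP xT; rewrite /B linmul0r.
apply: le_trans (ler_wpM2r _ (quadric_density BD BZ BC (B0 i) (B0 j) Bij)).
  apply: (collision_bound R (K := fun x => annihilates x C) (X := fun x => B x x == 0)).
  - by apply/card_gt0P; exists (i, 1%g).
  - by apply/annP => I; rewrite -(scale0r 0) linmulZl mul0r.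
  - move=> x y /annP xT /annP yT; apply/annP => I.
    by rewrite -scaleN1r linmulDl linmulZl xT yT mulr0 addr0.
  (* the annihilator lies in the radical of the form *)
  - move=> x y /eqP Bx Kyx; have Byx z : B (y - x) z = 0 by rewrite BC Bann.
    have -> : y = x + (y - x) by rewrite addrC subrK.
    by rewrite BD Byx addr0 BC BD Byx addr0 Bx.
  - by move=> [l z]; rewrite BZ BC BZ B0 !mulr0.
by apply: mean_ge0 => p; rewrite ler0n.
Qed.

(** If the minor [J] is nonzero, the coefficient of [X_j X^J] determines [x_j],
    for [j] outside [J], from the entries of [x] in [J]. *)
Lemma annihilator_density_le m n (C : 'M[F]_(m, n)) :
    (m <= n)%N -> ~~ degenerate C ->
  mean (fun x => (annihilates x C)%:R) <= q^-1 ^+ (n - m) :> R.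
Proof.
move=> mn /forallPn[J TJ]; set T := pminor C in TJ.
have q0 : 0 < q by rewrite ltr0n; apply/card_gt0P; exists 0.
have cardJ : #|J| = m.
  by apply/eqP; apply: contraR TJ => /(pminor_card C) TJ0; rewrite /T TJ0.
pose res (x : 'rV[F]_n) := [ffun j : {j | j \in J} => x 0 (val j)].
have res_inj : {in [pred x | annihilates x C] &, injective res}.
  move=> x y /forallP xT /forallP yT /ffunP exy.
  have eqJ j : j \in J -> x 0 j = y 0 j.
    by move=> jJ; have := exy (exist _ j jJ); rewrite !ffunE.
  apply/rowP => j; case: (boolP (j \in J)) => [|jJ]; first exact: eqJ.
  have /eqP : linmul x T (j |: J) - linmul y T (j |: J) = 0.
    by rewrite (eqP (xT _)) (eqP (yT _)) subrr.
  rewrite /linmul -sumrB big_setU1 //= setU1K // big1 => [|l lJ].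
    by rewrite addr0 -mulrBl mulf_eq0 (negPf TJ) orbF subr_eq0 => /eqP.
  by rewrite eqJ // subrr.
have card_le : (#|[pred x | annihilates x C]| <= #|F| ^ m)%N.
  rewrite -(card_in_image res_inj) (leq_trans (max_card _)) //.
  by rewrite card_ffun card_sig -cardJ.
rewrite /mean card_mx mul1n natrX -/q.
have -> : \sum_x (annihilates x C)%:R = #|[pred x | annihilates x C]|%:R :> R.
  rewrite -sum1_card natr_sum [RHS]big_mkcond; apply: eq_bigr => x _.
  by rewrite inE; case: ifP.
rewrite exprVn -[X in (_ ^+ X)](subnK mn) exprD invfM mulrCA -[X in _ <= X]mulr1.
rewrite ler_pM2l ?invr_gt0 ?exprn_gt0 // ler_pdivrMr ?exprn_gt0 // mul1r.
by rewrite /q -natrX ler_nat.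
Qed.

Lemma deg_probS_le m n : (m <= n)%N ->
  deg_prob m.+1 n <= deg_prob m n + q^-1 ^+ (n - m).
Proof.
move=> mn; rewrite deg_probS.
have C0 : (0 < #|{: 'M[F]_(m, n)}|)%N by apply/card_gt0P; exists 0.
have q0 : 0 < q by rewrite ltr0n; apply/card_gt0P; exists 0.
rewrite -[X in _ <= _ + X](mean_const _ C0) -meanD; apply: mean_le => C.
case: (boolP (degenerate C)) => [_|nd].
  by rewrite (le_trans (mean_le1 _ _)) // lerDl exprn_ge0 // invr_ge0 ltW.
by rewrite add0r annihilator_density_le.
Qed.

(** The geometric series of [deg_probS_le] sums up because
    [q^-(k+1) / (q - 1) + q^-(k+1) = q^-k / (q - 1)]. *)
Lemma deg_prob_le m n : (m < n)%N ->
  deg_prob m n <= q^-1 ^+ (n - m) / (q - 1).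
Proof.
have q3 := card_odd_field_ge3; rewrite -/q in q3.
elim: m => [|m IHm] mn.
  by rewrite deg_prob0 divr_ge0 ?exprn_ge0 ?invr_ge0 //; lra.
apply: le_trans (deg_probS_le (ltnW (ltnW mn))) _.
apply: le_trans (lerD (IHm (ltnW mn)) (lexx _)) _.
have -> : (n - m = (n - m.+1).+1)%N by lia.
rewrite exprS; set e := _ ^+ _; apply: ler_of_eq; field.
by rewrite !gt_eqF //; lra.
Qed.

(** A nondegenerate [C] contributes through
    [annihilator_density_collision].  For a degenerate one both the annihilator
    density and the collision probability are [1], and the second term makes up
    for the factor [(2q - 1) / q^2]. *)
Lemma deg_prob_rec m n : (m.+2 <= n.+1)%N ->
  deg_prob m.+1 n.+1 <=
    (2 * q - 1) / q ^+ 2 * (deg_prob m n + (n.+1%:R * (q - 1))^-1)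
    + (1 - (2 * q - 1) / q ^+ 2) * deg_prob m n.+1.
Proof.
set c := _ / _; move=> mn; have q3 := card_odd_field_ge3; rewrite -/q in q3.
have c_ge0 : 0 <= c by rewrite divr_ge0 ?exprn_ge0; lra.
have C0 : (0 < #|{: 'M[F]_(m, n.+1)}|)%N by apply/card_gt0P; exists 0.
have n0 : (0 < n)%N by lia.
have coll := ler_wpM2l c_ge0 (mean_collision m n0).
apply: le_trans (lerD coll (lexx _)).
rewrite deg_probS -!meanZ -meanD; apply: mean_le => C.
case: (boolP (degenerate C)) => [degC|nd]; last first.
  by rewrite mulr0 addr0; apply: annihilator_density_collision.
have -> : mean (fun p => (annihilates (axis_point p.1 - axis_point p.2) C)%:R) = 1 :> R.
  rewrite (eq_mean (g := fun=> 1)) ?mean_const //.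
    by apply/card_gt0P; exists ((ord0, 1%g), (ord0, 1%g)).
  by move=> p; rewrite degenerate_annihilates.
by rewrite !mulr1 addrC subrK mean_le1.
Qed.

(** Induction on [t] through [deg_prob_rec].  The geometric term is exact, as
    [c + (1 - c) / q = 1 - (1 - 1/q)^3].  For the linear term the step needs
    [c t / (n - 1) + 1 / (q - 1) <= 1]; this holds because both summands are at
    most [1/2], unless the linear term alone already exceeds the bound of
    [deg_prob_le]. *)
Lemma deg_prob_bound t m n : (t <= m < n)%N ->
  deg_prob m n <= (2 * q - 1) / q ^+ 2 * (t%:R / n%:R)
    + q^-1 ^+ (n - m) / (q - 1) * (1 - (1 - q^-1) ^+ 3) ^+ t.
Proof.
have q3 := card_odd_field_ge3; rewrite -/q in q3.
elim: t m n => [|t IHt] m n /andP[tm mn].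
  by rewrite mul0r mulr0 add0r expr0 mulr1 deg_prob_le.
case: m tm mn => // m tm; case: n => // n mn.
have tn : (t <= m < n)%N by rewrite -ltnS tm.
have tn1 : (t <= m < n.+1)%N by rewrite -ltnS tm ltnW.
have eS : (n.+1 - m = (n - m).+1)%N by rewrite subSn // ltnW.
have le_tn : (t * n.+1 <= t.+1 * n)%N.
  by rewrite mulnS mulSn leq_add2r ltnW // (leq_ltn_trans (n := m)) //; case/andP: tn.
set c := (2 * q - 1) / q ^+ 2; set rho := 1 - _.
have c_gt0 : 0 < c by rewrite divr_gt0 ?exprn_gt0; lra.
have c_lt1 : c < 1 by rewrite ltr_pdivrMr ?exprn_gt0; nra.
have qi_gt0 : 0 < q^-1 by rewrite invr_gt0; lra.
have qi_le : q^-1 <= 3^-1 by rewrite lef_pV2 ?posrE; lra.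
have rhoE : rho = c + (1 - c) * q^-1.
  by rewrite /rho /c; field; rewrite gt_eqF //; lra.
have rho_ge0 : 0 <= rho by rewrite rhoE; nra.
have n1_gt0 : 0 < n.+1%:R :> R by rewrite ltr0n.
have n_gt0 : 0 < n%:R :> R by rewrite ltr0n; case: (n) mn.
have [triv|small] := leP (q^-1 ^+ (n.+1 - m.+1) / (q - 1)) (c * (t.+1%:R / n.+1%:R)).
  apply: le_trans (deg_prob_le mn) _; apply: le_trans triv _.
  by rewrite lerDl mulr_ge0 ?exprn_ge0 // divr_ge0 ?exprn_ge0 ?ltW //; lra.
have {}small : c * (t%:R / n%:R) <= 2^-1.
  have e_le1 : q^-1 ^+ (n.+1 - m.+1) <= 1 by rewrite exprn_ile1 // ltW //; lra.
  have qm1 : (q - 1)^-1 <= 2^-1 by rewrite lef_pV2 ?posrE; lra.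
  have qm1_gt0 : 0 < (q - 1)^-1 by rewrite invr_gt0; lra.
  apply: le_trans (ltW (lt_le_trans small _)); last by nra.
  by rewrite ler_pM2l // ler_pdivrMr // mulrAC ler_pdivlMr // -!natrM ler_nat le_tn.
have := IHt m n; rewrite -/c -/rho => /(_ tn) IH1.
have := IHt m n.+1; rewrite -/c -/rho => /(_ tn1) IH2.
apply: le_trans (deg_prob_rec mn) _; rewrite -/c.
move: IH2; rewrite eS exprS subSS exprS => IH2.
set e := q^-1 ^+ (n - m) in IH1 IH2 *.
have := lerD (ler_wpM2l (ltW c_gt0) (lerD IH1 (lexx (n.+1%:R * (q - 1))^-1)))
  (ler_wpM2l (ltW (_ : 0 < 1 - c)) IH2).
rewrite subr_gt0 => /(_ c_lt1) /le_trans; apply.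
have qm1 : (q - 1)^-1 <= 2^-1 by rewrite lef_pV2 ?posrE; lra.
have key : c * (t%:R / n%:R) + (n.+1%:R * (q - 1))^-1 + (1 - c) * (t%:R / n.+1%:R)
   <= t.+1%:R / n.+1%:R.
  rewrite ler_pdivlMr // invfM.
  have -> : (c * (t%:R / n%:R) + n.+1%:R^-1 * (q - 1)^-1 + (1 - c) * (t%:R / n.+1%:R)) * n.+1%:R
    = t%:R + (q - 1)^-1 + c * (t%:R / n%:R).
    rewrite -natr1; field; rewrite natr1; rewrite !gt_eqF //; lra.
  by rewrite -natr1; lra.
have {}key := ler_wpM2l (ltW c_gt0) key.
(* only one of the [t.+1] factors [rho] is to be expanded *)
have step : e / (q - 1) * (rho * rho ^+ t) =
    (c + (1 - c) * q^-1) * (e / (q - 1) * rho ^+ t) by rewrite -rhoE mulrCA.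
rewrite step; apply: le_trans (lerD key (lexx _)).
by apply: ler_of_eq; ring.
Qed.

End Degeneracy.

(** * The permanent of a random matrix *)

From mathcomp Require Import all_classical all_reals all_analysis.

(** The permutations sending [i] to [j] are the liftings of the permutations
    between the complements of [i] and [j]. *)
Lemma reindex_lift_perm (R : nmodType) n (i j : 'I_n.+1) (f : 'S_n.+1 -> R) :
  \sum_(s : 'S_n.+1 | s i == j) f s = \sum_(s : 'S_n) f (lift_perm i j s).
Proof.
have inj_lift : injective (lift_perm i j).
  move=> s t st; apply/permP => k; apply: (@lift_inj _ j).
  by rewrite -!(lift_perm_lift i j) st.
have surj_lift (s : 'S_n.+1) : s i == j -> exists t, lift_perm i j t == s.
  move=> /eqP sij; pose t k := odflt k (unlift j (s (lift i k))).
  have tK k : lift j (t k) = s (lift i k).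
    rewrite /t; case: unliftP => [l -> //|/eqP]; rewrite -sij (inj_eq perm_inj).
    by rewrite eq_sym (negPf (neq_lift _ _)).
  have inj_t : injective t.
    by move=> k l kl; apply/(@lift_inj _ i)/(@perm_inj _ s); rewrite -!tK kl.
  exists (perm inj_t); apply/eqP/permP => k; case: (unliftP i k) => [l|] ->.
    by rewrite lift_perm_lift permE tK.
  by rewrite lift_perm_id.
rewrite (reindex (lift_perm i j)) /=.
  by apply: eq_bigl => s; rewrite lift_perm_id eqxx.
exists (fun s => odflt 1%g [pick t | lift_perm i j t == s]) => s; rewrite !inE.
  by case: pickP => [t /eqP/inj_lift -> //|/(_ s)]; rewrite eqxx.
by move=> /surj_lift[t ts]; case: pickP => [? /eqP //|/(_ t)]; rewrite ts.
Qed.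

Lemma expand_permanent_row (R : comNzRingType) n (A : 'M[R]_n.+1) (i : 'I_n.+1) :
  permanent A = \sum_j A i j * permanent (row' i (col' j A)).
Proof.
rewrite /permanent (partition_big (fun s : 'S_n.+1 => s i) predT) //=.
apply: eq_bigr => j _; rewrite reindex_lift_perm mulr_sumr.
apply: eq_bigr => s _; rewrite (bigD1_ord i) //= lift_perm_id; congr (_ * _).
by apply: eq_bigr => k _; rewrite !mxE lift_perm_lift.
Qed.

Lemma pminor_setT (F : finFieldType) n (A : 'M[F]_n) :
  pminor A [set: 'I_n]%SET = permanent A.
Proof.
elim: n A => [|n IHn] A.
  rewrite /permanent (big_pred1 1%g) => [|s]; last first.
    by apply/esym/eqP/permP => -[].
  rewrite big_ord0 /=; case: eqP => // -[]; apply/setP => -[] //.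
rewrite (expand_permanent_row A ord0) /=.
apply: eq_big => [j|j _]; first by rewrite inE.
congr (_ * _); first by rewrite mxE; congr (A _ _); apply: val_inj.
have -> : [set: 'I_n.+1]%SET :\ j = (lift j @: [set: 'I_n])%SET.
  apply/setP => l; rewrite !inE andbT; apply/idP/imsetP => [|[k _ ->]].
    by case: (unliftP j l) => [k ->|->]; [exists k|rewrite eqxx].
  by rewrite eq_sym neq_lift.
rewrite -pminor_col' IHn; congr permanent.
by apply/matrixP => r l; rewrite !mxE; congr (A _ _); apply: val_inj.
Qed.

Section Law.
Variables (R : realType) (F : finFieldType).
Hypothesis odd_F : odd #|F|.
Let q : R := #|F|%:R.

(** Moving along the coordinate [j] alone already makes the form uniform. *)
Lemma mean_linear_form n (T : {set 'I_n} -> F) (j : 'I_n) (y : F) :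
    T ([set: 'I_n]%SET :\ j) != 0 ->
  mean (fun x => (linmul x T [set: 'I_n]%SET == y)%:R) = q^-1.
Proof.
move=> Tj; have F0 : (0 < #|F|)%N by apply/card_gt0P; exists 0.
have V0 : (0 < #|{: 'rV[F]_n}|)%N by apply/card_gt0P; exists 0.
rewrite (mean_shift (fun p : F => p *: delta_mx 0 j)) // -[RHS](mean_const _ V0).
apply: eq_mean => x.
rewrite -(mean_affine_root R (linmul x T [set: 'I_n]%SET - y) Tj).
apply: eq_mean => p; rewrite linmulDl linmulZl linmul_delta inE mul1r.
by rewrite addrAC subr_eq0.
Qed.

Lemma permanent_distribution n (y : F) :
  mean (fun A : 'M[F]_n.+1 => (permanent A == y)%:R) =
  q^-1 + deg_prob R F n n.+1 * ((y == 0)%:R - q^-1).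
Proof.
have C0 : (0 < #|{: 'M[F]_(n, n.+1)}|)%N by apply/card_gt0P; exists 0.
have V0 : (0 < #|{: 'rV[F]_n.+1}|)%N by apply/card_gt0P; exists 0.
rewrite mean_col_mx mulrC -meanZ -[X in _ = X + _](mean_const _ C0) -meanD.
apply: eq_mean => C.
under eq_mean do rewrite -pminor_setT pminor_col_mx.
case: (boolP (degenerate C)) => [/forallP degC|/forallPn[J TJ]].
  rewrite mulr1 addrC subrK -[RHS](mean_const _ V0); apply: eq_mean => x.
  by rewrite linmul0r 1?eq_sym // => I; apply/eqP.
rewrite mulr0 addr0.
have /cards1P[j Jj] : #|~: J|%SET == 1.
  rewrite cardsCs finset.setCK card_ord; case: (eqVneq #|J| n) => [-> |]; first by rewrite subSnn.
  by move=> /(pminor_card C) TJ0; rewrite TJ0 eqxx in TJ.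
apply: (mean_linear_form (j := j)).
by rewrite finset.setTD -Jj finset.setCK.
Qed.

End Law.

Local Open Scope classical_set_scope.

(** Independence is applied to the events prescribing every entry, so each
    matrix has probability [q^-(n^2)]; the law of a function is then a count. *)
Lemma law_uniform_matrix (R : realType) (F : finFieldType) n
    (d : measure_display) (Omega : measurableType d) (P : probability Omega R)
    (A : Omega -> 'M[F]_n) (U : finType) (g : 'M[F]_n -> U) (y : U) :
    uniform_random_matrix P A ->
  law P (fun w => g (A w)) y = mean (fun M => (g M == y)%:R).
Proof.
move=> [mA indep unif].
have fiber M : A @^-1` [set M] =
    \bigcap_(ij in [set` [set: 'I_n * 'I_n]%SET]) (fun w => A w ij.1 ij.2) @^-1` [set M ij.1 ij.2].
  apply/seteqP; split => [w /= AM ij _ /=|w /= AM]; first by rewrite AM.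
  by apply/matrixP => i j; apply: (AM (i, j)); rewrite /= inE.
have P_entry ij x : P ((fun w => A w ij.1 ij.2) @^-1` [set x]) = ((#|F|%:R : R)^-1)%:E.
  have /(congr1 (fun f => f x)) := unif ij; rewrite /law /uniform_law => <-.
  rewrite fineK //; apply: fin_num_measure; exact: mA.
have P_fiber M : P (A @^-1` [set M]) = ((#|{: 'M[F]_n}|%:R : R)^-1)%:E.
  rewrite fiber (indep [set: 'I_n * 'I_n]%SET (fun ij => [set M ij.1 ij.2])).
  rewrite (eq_bigr (fun=> ((#|F|%:R : R)^-1)%:E)) => [|ij _]; last exact: P_entry.
  rewrite prodEFin prodr_const cardsT card_prod !card_ord card_mx exprVn -natrX.
  by [].
have m_fiber M : measurable (A @^-1` [set M]).
  rewrite fiber; apply: fin_bigcap_measurable => [|ij _]; last exact: mA.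
  exact: finite_finset.
pose S := enum [pred M | g M == y].
have -> : law P (fun w => g (A w)) y =
    fine (P (\bigcup_(M in [set` S]) A @^-1` [set M])).
  congr (fine (P _)); apply/seteqP; split => [w /= gw|w [M /=]].
    by exists (A w) => //=; rewrite mem_enum inE; apply/eqP.
  by rewrite mem_enum inE => /eqP gM ->.
rewrite measure_fin_bigcup //=; last first.
  by move=> M N _ _ [w [/= AM AN]]; rewrite -AM -AN.
rewrite -fsbig_seq ?enum_uniq // (eq_bigr (fun=> ((#|{: 'M[F]_n}|%:R : R)^-1)%:E)) => [|M _].
  rewrite sumEFin /= big_enum /= /mean mulr_suml [LHS]big_mkcond.
  by apply: eq_bigr => M _; rewrite inE; case: (g M == y); rewrite ?mul1r ?mul0r.
exact: P_fiber.
Qed.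

(** The law is the mixture of the point mass at zero, with weight
    [deg_prob R F n n.+1], and of the uniform law. *)
Lemma d_TV_permanent (R : realType) (F : finFieldType) (odd_F : odd #|F|) n :
  d_TV (fun y => mean (fun A : 'M[F]_n.+1 => (permanent A == y)%:R))
    (@uniform_law R F) = deg_prob R F n n.+1 * (1 - (#|F|%:R)^-1).
Proof.
set q : R := #|F|%:R; have q3 := card_odd_field_ge3 R odd_F; rewrite -/q in q3.
have qi_gt0 : 0 < q^-1 by rewrite invr_gt0; lra.
have qi_le1 : q^-1 <= 1 by rewrite invf_le1; lra.
have z_ge0 := deg_prob_ge0 R F n n.+1.
rewrite /d_TV (bigD1 0) //= (eq_bigr (fun=> deg_prob R F n n.+1 * q^-1)); last first.
  move=> y /negPf y0; rewrite permanent_distribution // /uniform_law y0 -/q.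
  by rewrite addrAC subrr add0r sub0r mulrN normrN ger0_norm // mulr_ge0 // ltW.
rewrite permanent_distribution // /uniform_law eqxx -/q addrAC subrr add0r.
rewrite ger0_norm; last by rewrite mulr_ge0 // subr_ge0.
have -> : \sum_(y : F | y != 0) deg_prob R F n n.+1 * q^-1 =
    #|predC1 (0 : F)|%:R * (deg_prob R F n n.+1 * q^-1).
  by rewrite mulr_natl -sumr_const.
rewrite cardC1 -subn1 natrB ?(ltnW (card_finNzRing_gt1 F)) // -/q.
have -> : true%:R = 1 :> R by [].
move: (deg_prob _ _ _ _) => z; field; rewrite gt_eqF //; lra.
Qed.

Theorem theorem1p2 (R : realType) (q : nat) (F : finFieldType)
  (card_F : #|F| = q) (odd_q : odd q)
  (n : nat) (n_ge1 : (1 <= n)%N)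
  (d : measure_display) (Omega : measurableType d) (P : probability Omega R)
  (A : Omega -> 'M[F]_n) (A_unif : uniform_random_matrix P A)
  (t : nat) (t_le : (t <= n - 1)%N) :
  d_TV (law P (fun w => permanent (A w))) (@uniform_law R F) <=
    ((q%:R - 1) * (2 * q%:R - 1)) / q%:R ^+ 3 * (t%:R / n%:R)
    + 1 / q%:R ^+ 2 * (1 - (1 - 1 / q%:R) ^+ 3) ^+ t.
Proof.
subst q; case: n n_ge1 A A_unif t_le => // n _ A A_unif.
rewrite subn1 /= => t_le; have q3 := card_odd_field_ge3 R odd_q.
have -> : law P (fun w => permanent (A w)) =
    fun y => mean (fun M : 'M[F]_n.+1 => (permanent M == y)%:R).
  by apply/funext => y; apply: law_uniform_matrix.
rewrite d_TV_permanent //.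
have bound : (t <= n < n.+1)%N by rewrite t_le ltnSn.
have {bound} := deg_prob_bound R odd_q bound.
rewrite subSnn expr1 !div1r; set q : R := #|F|%:R in q3 *.
have qi : 0 <= 1 - q^-1 by rewrite subr_ge0 invf_le1; lra.
move=> /(ler_wpM2r qi) /le_trans; apply; apply: ler_of_eq.
have n1_neq0 : n.+1%:R != 0 :> R by rewrite pnatr_eq0.
set rho := _ ^+ t; move: (n.+1%:R) n1_neq0 => N N0.
by field; rewrite N0 !gt_eqF //; lra.
Qed.
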